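(* Let $X=Y=[0,1)$ and $\mu=\nu$ Lebesgue measure. Let $\alpha\in[0,1)$ be irrational and $(\tau_n)_{n=0}^\infty$ a sequence of maps $\tau_n:[0,1)\to\mathbb{Z}$ with $\tau_0=0$, $\tau_1=1$, having properties (i)–(iv) listed in the context. For a subsequence $(i_j)_{j=2}^\infty$ of $\{2,3,\ldots\}$ define the cost function $c:[0,1)\times[0,1)\to[0,\infty]$ by $$c(x,y)=\begin{cases}h_+(x,y), & \text{if }(x,y)\text{ lies in the graph of one of } T^{0}_\alpha,\,T^{1}_\alpha,\,T^{(\tau_{i_2})}_\alpha,\,T^{(\tau_{i_3})}_\alpha,\ldots,T^{(\tau_{i_j})}_\alpha,\ldots,\\ \infty, & \text{otherwise.}\end{cases}$$ If $(i_j)_{j=2}^\infty$ tends sufficiently fast to infinity (that is: there is a function $F$, assigning a natural number to each finite sequence of natural numbers, such that the following holds whenever $i_{j+1}\ge F(i_2,\ldots,i_j)$ for all $j\ge2$), then, for this cost function $c$, the primal value $P$ is strictly positive, while the relaxed primal value $P^{\mathrm{rel}}$ as well as the dual value $D$ and the relaxed dual value $D^{\mathrm{rel}}$ are all equal to $0$. In particular there is a duality gap $P-D^{\mathrm{rel}}>0$, disproving the conjecture that $D^{\mathrm{rel}}=P$ holds for arbitrary Borel measurable cost functions $c:X\times Y\to[0,\infty]$ on the product of two polish spaces.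
   Context: $\oplus$ is addition modulo $1$; $h_+=\max(h,0)$; $\delta$ is the Riemannian (arc length) metric on $\mathbb{T}=[0,1)$, i.e. $\delta(x,y)=\min(|x-y|,1-|x-y|)$; $\mathbb{N}=\{1,2,\ldots\}$. For $k\in\mathbb{Z}$, $\varrho_k(x)=1+\#\{0\le i<k: x\oplus i\alpha\in[0,\frac12)\}-\#\{0\le i<k: x\oplus i\alpha\in[\frac12,1)\}$, where, for $k<0$, by ''$0\le i<k$'' is meant the index set $\{k+1,k+2,\ldots,0\}$. Set $h(x,y)=\varrho_k(x)$ if $y=x\oplus k\alpha$ with $k\in\mathbb{Z}$, and $h(x,y)=\infty$ otherwise. $T^k_\alpha(x)=x\oplus k\alpha$ and $T^{(\tau_n)}_\alpha(x)=T^{\tau_n(x)}_\alpha(x)=x\oplus\tau_n(x)\alpha$ (so $T^{(\tau_0)}_\alpha=T^0_\alpha=\mathrm{id}$, $T^{(\tau_1)}_\alpha=T^1_\alpha$). The properties required of $\alpha,(\tau_n)$: (i) Each $\tau_n$ is constant on each member of a countable collection of disjoint half open intervals in $[0,1)$ whose union has full measure; each $T^{(\tau_n)}_\alpha$, $n\ge0$, is a measure preserving almost sure bijection of $([0,1),\mu)$ onto itself; and $\int_{[0,1)}h(x,T^{(\tau_n)}_\alpha(x))\,dx=1$ for each $n\ge0$. (ii) There is a sequence $(\eta_n)_{n=1}^\infty$ tending to zero and there are Borel functions $g_n$ on $[0,1)$ with $\mu\{g_n=0\}=1-\eta_n$ and $\mu\{g_n=\frac{1-\eta_n}{\eta_n}\}=\eta_n$,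 such that $f_n(x):=h(x,T^{(\tau_n)}_\alpha(x))$ satisfies $\|f_n-g_n\|_{L^1(\mu)}<2^{-n}$, $n\ge1$. (iii) There is a sequence $(\varphi_m,\psi_m)_{m=1}^\infty$ of bounded Borel functions such that for every fixed $n\in\mathbb{N}$, $\lim_{m\to\infty}\|h(x,T^{(\tau_n)}_\alpha(x))-[\varphi_m(x)+\psi_m(T^{(\tau_n)}_\alpha(x))]\|_{L^1(\mu)}=0$, and $\lim_{m\to\infty}\big[\int_{[0,1)}\varphi_m(x)\,dx+\int_{[0,1)}\psi_m(y)\,dy\big]=1$. (iv) $\delta(x,T^{(\tau_n)}_\alpha(x))<2^{-n}$ for all $x\in[0,1)$, $n\ge1$. Values of the transport problem for a Borel cost $c$: $\Pi(\mu,\nu)$ is the set of Borel probability measures on $X\times Y$ with marginals $\mu,\nu$; $P=\inf\{\int c\,d\pi:\pi\in\Pi(\mu,\nu)\}$. $P^{\mathrm{rel}}=\lim_{\varepsilon\to0}\inf\{\int c\,d\pi\}$, where the infimum is over all nonnegative Borel measures $\pi$ on $X\times Y$ with total mass $\|\pi\|\ge1-\varepsilon$, first marginal $\le\mu$ and second marginal $\le\nu$. $D=\sup\{\int\varphi\,d\mu+\int\psi\,d\nu\}$ over pairs of $[-\infty,\infty)$-valued integrable Borel functions with $\varphi(x)+\psi(y)\le c(x,y)$ for all $(x,y)$. $D^{\mathrm{rel}}=\sup\{\int\varphi\,d\mu+\int\psi\,d\nu\}$ over pairs of integrable Borel functions such that $\varphi(x)+\psi(y)\le c(x,y)$ holds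 $\pi$-a.s. for every $\pi\in\Pi(\mu,\nu)$ with $\int c\,d\pi<\infty$.
   Formalization: Property (iii) is assumed for every n ≥ 0, so also for n = 0 (φ_m(x)+ψ_m(x) → 1 in L^1), not only for n ≥ 1; with n ≥ 1 alone the potentials are uncontrolled on the diagonal and P can be 0. *)

(* Defs.v *)
From HB Require Import structures.
From mathcomp Require Import all_boot all_order all_algebra.
From mathcomp Require Import all_classical all_reals all_analysis.
From mathcomp Require Import measurable_realfun.

Set Implicit Arguments.
Unset Strict Implicit.
Unset Printing Implicit Defensive.

Import Order.TTheory GRing.Theory Num.Theory.
Import numFieldNormedType.Exports.

Local Open Scope classical_set_scope.
Local Open Scope ring_scope.

Section Transport.
Context {R : realType} {d1 d2 : measure_display}.
Context {X : measurableType d1} {Y : measurableType d2}.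
Variables (mu : {measure set X -> \bar R}) (nu : {measure set Y -> \bar R}).
Variable c : X * Y -> \bar R.
Local Open Scope ereal_scope.

Definition transport_plan (pi : probability (X * Y)%type R) : Prop :=
  (forall A : set X, measurable A -> pushforward pi fst A = mu A) /\
  (forall B : set Y, measurable B -> pushforward pi snd B = nu B).

Definition primal : \bar R :=
  ereal_inf [set v | exists2 pi : probability (X * Y)%type R,
    transport_plan pi & v = \int[pi]_z c z].

Definition partial_plan (eps : R) (pi : {measure set (X * Y)%type -> \bar R})
    : Prop :=
  [/\ (1 - eps)%:E <= pi [set: X * Y],
      forall A : set X, measurable A -> pushforward pi fst A <= mu A &
      forall B : set Y, measurable B -> pushforward pi snd B <= nu B].

Definition primal_eps (eps : R) : \bar R :=
  ereal_inf [set v | exists2 pi : {measure set (X * Y)%type -> \bar R},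
    partial_plan eps pi & v = \int[pi]_z c z].

(* The limit always exists, see [is_cvg_primal_eps] below. *)
Definition primal_rel : \bar R :=
  lim (primal_eps eps @[eps --> (0 : R)^'+]).

Lemma is_cvg_primal_eps : cvg (primal_eps eps @[eps --> (0 : R)^'+]).
Proof.
apply: nonincreasing_at_right_is_cvge; apply: nearW => b x y _ _ xy.
apply: ereal_inf_le_tmp => v [pi [m1 m2 m3] ->]; exists pi => //; split => //.
by apply: le_trans m1; rewrite lee_fin lerD2l lerN2.
Qed.

(* Integrable Borel functions with values in [-oo, +oo). *)
Definition dual_fun {d} {T : measurableType d} (m : {measure set T -> \bar R})
    (f : T -> \bar R) : Prop :=
  m.-integrable [set: T] f /\ forall x, f x < +oo.

Definition dual_value (phi : X -> \bar R) (psi : Y -> \bar R) : \bar R :=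
  \int[mu]_x phi x + \int[nu]_y psi y.

Definition dual : \bar R :=
  ereal_sup [set v | exists phi psi,
    [/\ dual_fun mu phi, dual_fun nu psi,
        forall x y, phi x + psi y <= c (x, y) & v = dual_value phi psi]].

Definition dual_rel : \bar R :=
  ereal_sup [set v | exists phi psi,
    [/\ dual_fun mu phi, dual_fun nu psi,
        forall pi : probability (X * Y)%type R, transport_plan pi ->
          \int[pi]_z c z < +oo ->
          {ae pi, forall z, phi z.1 + psi z.2 <= c z} &
        v = dual_value phi psi]].

End Transport.

Notation borel T := (g_sigma_algebraType (@open T)).

Definition polish (R : realType) (T : topologicalType) : Prop :=
  (exists dist : T -> T -> R,
    [/\ forall x y, dist x y = 0 <-> x = y,
        forall x y, dist x y = dist y x,
        forall x y z, dist x z <= dist x y + dist y z,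
        forall x (A : set T), nbhs x A <->
          exists2 e : R, 0 < e & [set y | dist x y < e] `<=` A &
        forall u : nat -> T,
          (forall e : R, 0 < e -> exists N, forall m n,
            (N <= m)%N -> (N <= n)%N -> dist (u m) (u n) < e) ->
          exists l : T, u @ \oo --> l]) /\
  (exists2 S : set T, countable S & dense S).

(* The product of two Polish spaces carries the product of the two Borel
   sigma-algebras, which is its Borel sigma-algebra. *)
Definition relaxed_duality_conjecture (R : realType) : Prop :=
  forall (X Y : ptopologicalType), polish R X -> polish R Y ->
  forall (mu : probability (borel X) R) (nu : probability (borel Y) R)
    (c : (borel X * borel Y)%type -> \bar R),
  measurable_fun [set: (borel X * borel Y)%type] c -> (forall z, 0 <= c z)%E ->
  dual_rel mu nu c = primal mu nu c.

Section Circle.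
Variable R : realType.

Definition circle : Type := set_type (`[0, 1[%classic : set R).

HB.instance Definition _ := Topological.copy circle
  (set_type (`[0, 1[%classic : set R)).

Definition circle_val (x : circle) : R := set_val x.

Lemma frac_itv (t : R) :
  t - (Num.floor t)%:~R \in (`[0, 1[%classic : set R).
Proof.
by rewrite inE /= in_itv /= subr_ge0 floor_le /= ltrBlDl -intrD1 floorD1_gt.
Qed.

Definition frac (t : R) : circle := SigSub (frac_itv t).

HB.instance Definition _ := isPointed.Build circle (frac 0).

Definition lebesgue_circle (A : set (borel circle)) : \bar R :=
  lebesgue_measure (circle_val @` A : set (measurableTypeR R)).

Lemma circle_valP (x : circle) : 0 <= circle_val x < 1.
Proof. by have := valP x; rewrite inE /= in_itv. Qed.

Lemma circle_val_inj : injective circle_val.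
Proof. by move=> x y; exact: val_inj. Qed.

Lemma image_circle_val_setT : circle_val @` [set: circle] = `[0, 1[%classic.
Proof.
apply/seteqP; split=> [_ [x _ <-]|x x01] /=; first by rewrite in_itv /= circle_valP.
by exists (SigSub (mem_set x01)).
Qed.

Lemma measurable_circle_val (A : set (borel circle)) :
  measurable A -> measurable (circle_val @` A : set (measurableTypeR R)).
Proof.
have opE : @open circle =
    preimage_set_system [set: circle] circle_val (@open R).
  apply/seteqP; split=> [_ [B oB <-]|_ [B oB <-]].
    by exists B => //; rewrite setTI.
  by exists B => //; rewrite setTI.
rewrite /measurable /= opE g_sigma_preimageE => -[B mB <-].
have mB' : measurable (B : set (measurableTypeR R)).
  have : <<s @open R >> `<=` (measurable : set (set (measurableTypeR R))).
    apply: smallest_sub; last by move=> U; exact: open_measurable.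
    exact: sigma_algebra_measurable.
  exact.
rewrite setTI; have -> : circle_val @` (circle_val @^-1` B) = `[0, 1[ `&` B.
  apply/seteqP; split=> [_ [x Bx <-]|x [x01 Bx]] /=.
    by split => //; rewrite /= in_itv /= circle_valP.
  by exists (SigSub (mem_set x01)).
by apply: (measurableI (s := measurableTypeR R)) => //; exact: measurable_itv.
Qed.

Let lebesgue_circle0 : lebesgue_circle set0 = 0%E.
Proof. by rewrite /lebesgue_circle image_set0 measure0. Qed.

Let lebesgue_circle_ge0 A : (0 <= lebesgue_circle A)%E.
Proof. exact: measure_ge0. Qed.

Let lebesgue_circle_sigma_additive : semi_sigma_additive lebesgue_circle.
Proof.
move=> F mF tF mUF; rewrite /lebesgue_circle image_bigcup.
apply: measure_semi_sigma_additive.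
- by move=> n; exact: measurable_circle_val.
- apply/trivIsetP => i j _ _ ij; apply/seteqP; split=> // _ [[x Fx <-] [y Fy]].
  move=> /circle_val_inj yx; move/trivIsetP : tF => /(_ i j I I ij) /seteqP[+ _].
  by move=> /(_ x); apply; split => //; rewrite -yx.
- by rewrite -image_bigcup; exact: measurable_circle_val.
Qed.

HB.instance Definition _ := isMeasure.Build _ _ _ lebesgue_circle
  lebesgue_circle0 lebesgue_circle_ge0 lebesgue_circle_sigma_additive.

Let lebesgue_circle_setT : lebesgue_circle setT = 1%E.
Proof.
rewrite /lebesgue_circle image_circle_val_setT lebesgue_measure_itv /= lte_fin.
by rewrite ltr01 oppr0 adde0.
Qed.

HB.instance Definition _ := Measure_isProbability.Build _ _ _ lebesgue_circle
  lebesgue_circle_setT.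

End Circle.

Section Cost.
Context {R : realType}.
Local Notation I := (borel (circle R)).
Local Notation mu := (lebesgue_circle (R := R)).

Definition oplus (x : I) (t : R) : I := frac (circle_val x + t).

Definition dist_circle (x y : I) : R :=
  Num.min `|circle_val x - circle_val y| (1 - `|circle_val x - circle_val y|).

Definition rot (alpha : R) (k : int) (x : I) : I := oplus x (k%:~R * alpha).

Definition rot_by (alpha : R) (tau : I -> int) (x : I) : I :=
  rot alpha (tau x) x.

(* The index set written "0 <= i < k": it is {0, ..., k - 1} for k >= 0 and
   {k + 1, ..., 0} for k < 0; recall that [Negz m] is - (m + 1). *)
Definition index_range (k : int) : seq int :=
  match k with
  | Posz m => [seq Posz i | i <- iota 0 m]
  | Negz m => [seq - Posz i | i <- iota 0 m.+1]
  end.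

Definition varrho (alpha : R) (k : int) (x : I) : int :=
  1 + Posz (count (fun i => circle_val (rot alpha i x) < 2^-1) (index_range k))
    - Posz (count (fun i => 2^-1 <= circle_val (rot alpha i x)) (index_range k)).

(* For alpha irrational there is at most one k with y = x (+) k alpha. *)
Definition hcost (alpha : R) (x y : I) : \bar R :=
  if pselect (exists k : int, y = rot alpha k x) is left ex_k
  then ((varrho alpha (projT1 (cid ex_k)) x)%:~R)%:E
  else +oo%E.

(* The values i 0 and i 1 are not used: the subsequence is (i j) for j >= 2. *)
Definition on_graphs (alpha : R) (tau : nat -> I -> int) (i : nat -> nat)
    (x y : I) : Prop :=
  [\/ y = rot alpha 0 x, y = rot alpha 1 x |
    exists2 j, (2 <= j)%N & y = rot_by alpha (tau (i j)) x].

Definition cost (alpha : R) (tau : nat -> I -> int) (i : nat -> nat)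
    (z : I * I) : \bar R :=
  if pselect (on_graphs alpha tau i z.1 z.2)
  then maxe (hcost alpha z.1 z.2) 0
  else +oo%E.

(* a k = b k gives the empty interval, so finite collections are included. *)
Definition step_function (tau : I -> int) : Prop :=
  exists a b : nat -> R,
    let J := fun k => [set x : I | a k <= circle_val x < b k] in
    [/\ forall k, 0 <= a k /\ a k <= b k <= 1,
        trivIset [set: nat] J,
        mu (\bigcup_k J k) = 1%E &
        forall k x y, J k x -> J k y -> tau x = tau y].

Definition measure_preserving (T : I -> I) : Prop :=
  measurable_fun [set: I] T /\
  forall A : set I, measurable A -> mu (T @^-1` A) = mu A.

Definition ae_bijective (T : I -> I) : Prop :=
  exists A B : set I,
    [/\ measurable A, measurable B, mu A = 1%E, mu B = 1%E & set_bij A B T].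

Definition cost_along (alpha : R) (tau : I -> int) (x : I) : \bar R :=
  hcost alpha x (rot_by alpha tau x).

Definition orbit_bijections (alpha : R) (tau : nat -> I -> int) : Prop :=
  forall n, [/\ step_function (tau n),
    measure_preserving (rot_by alpha (tau n)),
    ae_bijective (rot_by alpha (tau n)) &
    (\int[mu]_x cost_along alpha (tau n) x = 1)%E].

Definition concentrated_costs (alpha : R) (tau : nat -> I -> int) : Prop :=
  exists (eta : nat -> R) (g : nat -> I -> R),
    eta @ \oo --> (0 : R) /\
    forall n, (1 <= n)%N ->
      [/\ measurable_fun [set: I] (g n),
          mu [set x | g n x = 0] = (1 - eta n)%:E,
          mu [set x | g n x = (1 - eta n) / eta n] = (eta n)%:E &
          ('N[mu]_1[(fun x => cost_along alpha (tau n) x - (g n x)%:E)]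
            < (2 ^- n)%:E)%E].

Definition bounded_borel (f : I -> R) : Prop :=
  measurable_fun [set: I] f /\ exists M : R, forall x, `|f x| <= M.

(* n = 0 is included: the diagonal, the graph of T^(tau 0) = id, is one of the
   graphs that carry the cost, and a condition on n >= 1 alone would leave
   phi m + psi m uncontrolled there (the primal value could then be 0). *)
Definition approximate_potentials (alpha : R) (tau : nat -> I -> int) : Prop :=
  exists phi psi : nat -> I -> R,
    [/\ forall m, bounded_borel (phi m) /\ bounded_borel (psi m),
        forall n,
          'N[mu]_1[(fun x => cost_along alpha (tau n) x -
            (phi m x + psi m (rot_by alpha (tau n) x))%R%:E)]%E @[m --> \oo]
            --> 0%E &
        (\int[mu]_x (phi m x)%:E + \int[mu]_y (psi m y)%:E)%E @[m --> \oo]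
          --> 1%E].

Definition near_identity (alpha : R) (tau : nat -> I -> int) : Prop :=
  forall n, (1 <= n)%N ->
    forall x, dist_circle x (rot_by alpha (tau n) x) < 2 ^- n.

End Cost.

(* Main.v *)
Require Import Defs.
From HB Require Import structures.
From mathcomp Require Import all_boot all_order all_algebra.
From mathcomp Require Import all_classical all_reals all_analysis.
From mathcomp Require Import measurable_realfun.
From mathcomp Require Import ring lra zify.

Set Implicit Arguments.
Unset Strict Implicit.
Unset Printing Implicit Defensive.

Import Order.TTheory GRing.Theory Num.Theory.
Import numFieldNormedType.Exports.

Local Open Scope classical_set_scope.
Local Open Scope ring_scope.

(** The primal value is at least 1/4.  Given finitely many of the graphs, take
    approximate potentials phi, psi whose sum is L^1-close to h on each of them;
    in particular phi + psi is close to 1 on the diagonal.  The integral of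
    |h - phi - psi| over a graph against a plan is at most its L^1-norm along
    that graph, because the marginals of the plan are Lebesgue measure.  Far graphs are close to the diagonal
    and psi is continuous up to an L^1-error, so phi(x) + psi(y) is at most 1
    there up to an L^1-error controlled by the marginals alone.  As the total
    integral of phi + psi is close to 1, a plan costs at least 1 minus the mass
    it gives to the far graphs, up to a fixed small error; this mass tends to 0
    as more graphs are declared near.

    The relaxed values vanish because the n-th graph carries almost no cost
    outside a set of measure eta_n: dropping that set gives partial plans of
    cost tending to 0, and integrable potentials gain nothing on it. *)

(** * Measurability of the cost *)

Section CircleMeasurability.
Variable R : realType.
Local Notation I := (borel (circle R)).
Local Notation frac := (@Defs.frac R).
Local Notation rot := Defs.rot.
Implicit Types (x y : I) (t : R) (k : int).

Lemma circle_val_frac t : circle_val (frac t) = t - (Num.floor t)%:~R.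
Proof. by []. Qed.

Lemma frac_circle_val x : frac (circle_val x) = x.
Proof.
apply: circle_val_inj; rewrite circle_val_frac.
by rewrite (@floor_def _ _ 0) ?subr0// add0r circle_valP.
Qed.

Lemma open_circleE : @open (circle R) =
  preimage_set_system [set: circle R] (@circle_val R) (@open R).
Proof.
apply/seteqP; split=> [_ [B oB <-]|_ [B oB <-]].
  by exists B => //; rewrite setTI.
by exists B => //; rewrite setTI.
Qed.

Lemma measurable_circle_valE :
  measurable_fun [set: I] (@circle_val R : I -> R).
Proof.
apply: (measurability _ (RGenOpens.measurableE R)).
move=> _ [_ [a [b ->] <-]]; apply: sub_sigma_algebra.
by rewrite open_circleE; exists `]a, b[%classic => //; exact: interval_open.
Qed.

Lemma measurable_frac : measurable_fun [set: R] (frac : R -> I).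
Proof.
apply: (measurability (@open (circle R) : set (set I))) => [//|].
move=> _ [_ [B oB <-] <-].
have mfl : measurable_fun [set: R] (fun t : R => t - (Num.floor t)%:~R).
  apply: measurable_funB => //; apply: nondecreasing_measurable => //.
  by move=> s t st; rewrite ler_int le_floor.
have -> : [set: R] `&` frac @^-1` (set_val @^-1` B) =
  [set: R] `&` (fun t : R => t - (Num.floor t)%:~R) @^-1` B by [].
by apply: mfl => //; exact: open_measurable.
Qed.

Lemma measurable_rot alpha k : measurable_fun [set: I] (rot alpha k : I -> I).
Proof.
apply: (measurableT_comp measurable_frac).
by apply: measurable_funD => //; exact: measurable_circle_valE.
Qed.

Lemma measurable_varrho alpha k :
  measurable_fun [set: I] (fun x => (varrho alpha k x)%:~R : R).
Proof.
have mcount (P : R -> bool) (s : seq int) : measurable_fun [set: R] P ->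
    measurable_fun [set: I]
      (fun x => (count (fun i => P (circle_val (rot alpha i x))) s)%:R : R).
  move=> mP; elim: s => [|i s IH] //=.
  under eq_fun do rewrite natrD.
  apply: measurable_funD => //.
  have -> : (fun x => (P (circle_val (rot alpha i x)))%:R : R) =
      fun x => if P (circle_val (rot alpha i x)) then 1 else 0 :> R.
    by apply/funext => x; case: (P _).
  apply: measurable_fun_ifT => //.
  apply: (measurableT_comp mP);
    apply: (measurableT_comp measurable_circle_valE).
  exact: measurable_rot.
rewrite /varrho; under eq_fun do rewrite intrB intrD.
apply: measurable_funB; first apply: measurable_funD => //.
  by apply: (mcount (fun t => t < 2^-1)); apply: measurable_fun_ltr.
by apply: (mcount (fun t => 2^-1 <= t)); apply: measurable_fun_ler.
Qed.

(** Two equal rotates force [(k - l) * alpha] to be an integer; for distinct [k] and [l] this would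
    make [alpha] rational. *)
Lemma rot_inj alpha k l x : irrational alpha ->
  rot alpha k x = rot alpha l x -> k = l.
Proof.
move=> irr /(congr1 (@circle_val R)); rewrite !circle_val_frac => e.
set a := Num.floor (circle_val x + k%:~R * alpha) in e.
set b := Num.floor (circle_val x + l%:~R * alpha) in e.
have {}e : (k - l)%:~R * alpha = (a - b)%:~R.
  move: e; rewrite !intrB mulrBl; move: (circle_val x : R) => u; lra.
apply/eqP; apply: contraPT irr => kl; apply; rewrite /rational.
have kl0 : (k - l)%:~R != 0 :> R by rewrite intr_eq0 subr_eq0.
exists ((a - b)%:~R / (k - l)%:~R) => //.
by rewrite fmorph_div /= !ratr_int -e mulrAC divff// mul1r.
Qed.

Lemma measurable_graph (T : I -> I) : measurable_fun [set: I] T ->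
  measurable [set z : I * I | z.2 = T z.1].
Proof.
move=> mT; rewrite [X in measurable X](_ : _ = [set: I * I] `&`
  (fun z : I * I => circle_val z.2 == circle_val (T z.1)) @^-1` [set true]).
  apply: measurable_fun_eqr => //.
    by apply: (measurableT_comp measurable_circle_valE).
  apply: (measurableT_comp measurable_circle_valE).
  exact: (measurableT_comp mT).
rewrite setTI; apply/seteqP; split => z /=; first by move=> ->; rewrite eqxx.
by move/eqP/circle_val_inj.
Qed.

(** The cover is reindexed by [nat] through [unpickle]; numbers that code no integer contribute the
    empty set. *)
Lemma measurable_fun_int_cover {d d'} {T : measurableType d}
    {U : measurableType d'} (E : int -> set T) (f : T -> U) :
  (forall k, measurable (E k)) -> (forall k, measurable_fun (E k) f) ->
  measurable_fun (~` \bigcup_k E k) f -> measurable_fun [set: T] f.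
Proof.
move=> mE mf mfC.
pose E' n := if @unpickle int n is Some k then E k else set0.
have E'E : \bigcup_n E' n = \bigcup_k E k.
  apply/seteqP; split => [x [n _]|x [k _ Ekx]].
    by rewrite /E'; case: unpickle => // k Ekx; exists k.
  by exists (pickle k) => //; rewrite /E' pickleK.
have mE' n : measurable (E' n) by rewrite /E'; case: unpickle.
rewrite -(setUv (\bigcup_k E k)) -E'E; apply/measurable_funU.
- exact: bigcup_measurable.
- by apply: measurableC; exact: bigcup_measurable.
split; last by rewrite E'E.
apply/measurable_fun_bigcup => // n; rewrite /E'.
by case: unpickle => // ; exact: measurable_fun_set0.
Qed.

Variable alpha : R.
Hypothesis irr : irrational alpha.

Lemma hcost_rot k x :
  hcost alpha x (rot alpha k x) = ((varrho alpha k x)%:~R)%:E.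
Proof.
rewrite /hcost; case: pselect => [ex|]; last by case; exists k.
by case: (cid ex) => l /= /(rot_inj irr) ->.
Qed.

(** The graphs of the rotations cover the set where [hcost] is finite; on each it is a [varrho],
    elsewhere it is constantly [+oo]. *)
Lemma measurable_hcost :
  measurable_fun [set: I * I] (fun z : I * I => hcost alpha z.1 z.2).
Proof.
apply: (measurable_fun_int_cover
  (E := fun k => [set z : I * I | z.2 = rot alpha k z.1])) => [k|k|].
- exact: measurable_graph (measurable_rot _ _).
- apply: (eq_measurable_fun (fun z : I * I => ((varrho alpha k z.1)%:~R)%:E)).
    by move=> z; rewrite inE /= => ->; rewrite hcost_rot.
  apply: measurable_funTS; apply/measurable_EFinP.
  exact: (measurableT_comp (measurable_varrho _ _)).
- apply: (eq_measurable_fun (cst +oo%E)) => // z; rewrite inE /= => nz.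
  by rewrite /hcost; case: pselect => // -[k kz]; case: nz; exists k.
Qed.

Lemma measurable_cost_along tau : measurable_fun [set: I] (rot_by alpha tau) ->
  measurable_fun [set: I] (cost_along alpha tau).
Proof.
move=> mT; rewrite /cost_along.
apply: (measurableT_comp measurable_hcost
  (g := fun x => (x, rot_by alpha tau x))).
exact: measurable_fun_pair.
Qed.

Lemma cost_along_fin_num tau x : cost_along alpha tau x \is a fin_num.
Proof. by rewrite /cost_along /rot_by hcost_rot. Qed.

Lemma measurable_on_graphs (tau : nat -> I -> int) (i : nat -> nat) :
  (forall n, measurable_fun [set: I] (rot_by alpha (tau n))) ->
  measurable [set z : I * I | on_graphs alpha tau i z.1 z.2].
Proof.
move=> mT.
rewrite [X in measurable X](_ : _ = [set z : I * I | z.2 = rot alpha 0 z.1] `|`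
  [set z : I * I | z.2 = rot alpha 1 z.1] `|`
  \bigcup_(j in [set j | (2 <= j)%N])
  [set z : I * I | z.2 = rot_by alpha (tau (i j)) z.1]).
  apply: measurableU; first apply: measurableU.
  - exact: measurable_graph (measurable_rot _ _).
  - exact: measurable_graph (measurable_rot _ _).
  - by apply: bigcup_measurable => j _; exact: measurable_graph.
apply/seteqP; split=> z /= => [[?|?|[j ? ?]]|[[?|?]|[j ? ?]]].
- by left; left.
- by left; right.
- by right; exists j.
- by constructor 1.
- by constructor 2.
- by constructor 3; exists j.
Qed.

Lemma measurable_cost (tau : nat -> I -> int) (i : nat -> nat) :
  (forall n, measurable_fun [set: I] (rot_by alpha (tau n))) ->
  measurable_fun [set: I * I] (cost alpha tau i).
Proof.
move=> mT; rewrite (_ : cost _ _ _ = fun z =>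
  if `[< on_graphs alpha tau i z.1 z.2 >] then maxe (hcost alpha z.1 z.2) 0%E
  else +oo%E).
  apply: measurable_fun_ifT => //.
    apply: (@measurable_fun_bool _ _ _ _ true).
    rewrite setTI [X in measurable X](_ : _ =
      [set z : I * I | on_graphs alpha tau i z.1 z.2]).
      exact: measurable_on_graphs.
    by apply/seteqP; split => z /= /asboolP.
  by apply: measurable_maxe => //; exact: measurable_hcost.
by apply/funext => z; rewrite /cost; case: pselect => p; case: asboolP.
Qed.

Lemma cost_ge0 tau i z : (0 <= cost alpha tau i z)%E.
Proof. by rewrite /cost; case: pselect => p //; rewrite le_max lexx orbT. Qed.

End CircleMeasurability.

(** * L^1-continuity on the circle *)

Section ImageMeasure.
Context {R : realType} {d1 d2 : measure_display}.
Context {X : measurableType d1} {Y : measurableType d2}.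

Definition image_measure (m : {measure set X -> \bar R}) (f : X -> Y)
    (mf : measurable_fun [set: X] f) : {measure set Y -> \bar R} :=
  measure_function_pushforward__canonical__measure_function_Measure m mf.

Lemma image_measureE m f (mf : measurable_fun [set: X] f) A :
  image_measure m mf A = m (f @^-1` A).
Proof. by []. Qed.

Lemma ge0_integral_image_measure m f (mf : measurable_fun [set: X] f)
    (D : set Y) (g : Y -> \bar R) :
  measurable D -> measurable_fun [set: Y] g -> (forall y, 0 <= g y)%E ->
  (\int[image_measure m mf]_(y in D) g y = \int[m]_(x in f @^-1` D) g (f x))%E.
Proof.
by move=> mD mg g0; rewrite ge0_integral_pushforward//; exact: measurable_funTS.
Qed.

Definition image_probability (P : probability X R) (f : X -> Y)
    (mf : measurable_fun [set: X] f) : probability Y R :=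
  distribution P
    (HB.pack_for {mfun X >-> Y} f (isMeasurableFun.Build _ _ _ _ f mf)).

Lemma image_probabilityE P f (mf : measurable_fun [set: X] f) A :
  image_probability P mf A = P (f @^-1` A).
Proof. by []. Qed.

End ImageMeasure.

Lemma ge0_integral_EFinD {d} {T : measurableType d} {R : realType}
    (m : {measure set T -> \bar R}) (f g : T -> R) :
  measurable_fun [set: T] f -> measurable_fun [set: T] g ->
  (forall x, 0 <= f x) -> (forall x, 0 <= g x) ->
  (\int[m]_x (f x + g x)%:E = \int[m]_x (f x)%:E + \int[m]_x (g x)%:E)%E.
Proof.
move=> mf mg f0 g0; under eq_integral do rewrite EFinD.
apply: ge0_integralD => //; try exact/measurable_EFinP.
- by move=> x _; rewrite lee_fin.
- by move=> x _; rewrite lee_fin.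
Qed.

Section Approximation.
Variable R : realType.
Local Notation I := (borel (circle R)).
Local Notation mu := (lebesgue_circle (R := R)).
Local Notation frac := (@Defs.frac R).
Implicit Types (x y : I) (t : R).

(** Pushing [mu] forward along [circle_val] gives Lebesgue measure on [0, 1). *)
Lemma ge0_integral_circle (f : R -> \bar R) :
  measurable_fun [set: R] f -> (forall t, 0 <= f t)%E ->
  (\int[mu]_x f (circle_val x) =
   \int[lebesgue_measure]_(t in `[0%R, 1%R[) f t)%E.
Proof.
move=> mf f0.
have mv : measurable_fun [set: I] (@circle_val R : I -> measurableTypeR R).
  exact: measurable_circle_valE.
have e01 : [set: I] = (@circle_val R : I -> R) @^-1` `[0, 1[%classic.
  by apply/seteqP; split => x //= _; rewrite in_itv /= circle_valP.
rewrite e01 -(ge0_integral_image_measure mu mv) //.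
rewrite (eq_measure_integral lebesgue_measure)// => A mA A01.
rewrite image_measureE /= /lebesgue_circle; congr (lebesgue_measure _).
apply/seteqP; split => [_ [x Ax <-] //|t At].
have t01 := A01 _ At; by exists (SigSub (mem_set t01)).
Qed.

(** Uniform continuity from the compactness of [0, 1], in its covering form; the second point may
    leave the segment. *)
Lemma continuous_unif01 (g : R -> R) (e : R) : continuous g -> 0 < e ->
  exists N, forall s t, 0 <= s <= 1 -> `|s - t| < 2 ^- N -> `|g s - g t| < e.
Proof.
move=> cg e0.
have /compact_near_coveringP cK := @segment_compact R 0 1.
have := cK nat \oo (fun N s => forall t, `|s - t| < 2 ^- N -> `|g s - g t| < e).
case.
  move=> s _.
  have /cvgrPdist_lt /(_ (e / 2)) := cg s.
  rewrite divr_gt0// => /(_ isT) /nbhs_ballP [d /= d0 dP].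
  (* With [d / 2] for both the ball and the modulus, [s'] and [t] stay within [d] of [s], and the
     triangle inequality through [g s] applies. *)
  exists (ball s (d / 2), [set N | 2 ^- N < d / 2]).
    split; first by apply: nbhsx_ballx; rewrite divr_gt0.
    have d20 : 0 < d / 2 by rewrite divr_gt0.
    have [N _ NP] := @near_infty_natSinv_expn_lt R (PosNum d20).
    by exists N => // n /NP /=; rewrite div1r.
  move=> [s' N] /= [ss' Nd] t s't.
  rewrite /ball /= in ss'.
  have gs' : `|g s - g s'| < e / 2 by apply: dP; rewrite /ball /=; lra.
  have gt' : `|g s - g t| < e / 2.
    apply: dP; rewrite /ball /=.
    by rewrite (le_lt_trans (ler_distD s' _ _))//; lra.
  by rewrite (le_lt_trans (ler_distD (g s) _ _))// distrC; lra.
move=> N _ NP; exists N => s t s01.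
have := NP N (leqnn N) s; rewrite /= in_itv /= => /(_ s01); exact.
Qed.

(** Extended to the line by [frac], [psi] is bounded, hence integrable on [0, 1), where continuous
    functions are dense in L^1. The approximant [g] lives on the line and need not be periodic. *)
Lemma L1_continuous_approx (psi : I -> R) (e : R) : bounded_borel psi ->
  0 < e ->
  exists2 g : R -> R, continuous g &
    (\int[mu]_x `|psi x - g (circle_val x)|%:E < e%:E)%E.
Proof.
move=> [mpsi [M psiM]] e0.
have mpf : measurable_fun [set: R] (psi \o frac).
  exact: measurableT_comp (@measurable_frac R).
have l01 : (lebesgue_measure (`[0%R, 1%R[%classic : set R) < +oo)%E.
  by rewrite lebesgue_measure_itv /= lte_fin ltr01 -EFinB ltry.
have : lebesgue_measure.-integrable (`[0%R, 1%R[%classic : set R)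
    (EFin \o (psi \o frac)).
  apply: measurable_bounded_integrable => //; first exact: measurable_funTS.
  exists M; split; first by rewrite num_real.
  by move=> K MK t _ /=; rewrite (le_trans (psiM _))// ltW.
move=> /(approximation_continuous_integrable (measurable_itv _) l01).
move=> [g_ [cg _]] cvg0.
have [N _ /(_ N)] : \forall n \near \oo,
  (\int[lebesgue_measure]_(z in `[0%R, 1%R[)
   `|((psi \o frac) z - g_ n z)%:E| < e%:E)%E.
  apply: (cvg0 [set u | (u < e%:E)%E]).
  by apply: open_ereal_lt'; rewrite lte_fin.
move=> /(_ (leqnn _)) gN; exists (g_ N) => //.
move: gN; rewrite -ge0_integral_circle//; last first.
  apply: measurableT_comp => //; apply/measurable_EFinP.
  by apply: measurable_funB => //; exact: continuous_measurable_fun.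
congr (_ < _)%E; apply: eq_integral => x _ /=.
by rewrite frac_circle_val.
Qed.

(* Points that are close on the circle but not on the line straddle the endpoint
   0; the set [bad] in the proof accounts for such pairs. *)
Lemma L1_modulus (psi : I -> R) (e : R) : bounded_borel psi -> 0 < e ->
  exists N (r : I -> R),
    [/\ measurable_fun [set: I] r, forall x, 0 <= r x,
      (\int[mu]_x (r x)%:E < e%:E)%E &
      forall x y, dist_circle x y < 2 ^- N -> psi y <= psi x + r x + r y].
Proof.
move=> bpsi e0.
have e4 : 0 < e / 4 by rewrite divr_gt0.
have [g cg psig] := L1_continuous_approx bpsi e4.
have [N1 N1P] := continuous_unif01 cg e4.
have [c _ cM] : exists2 c, c \in `[0, 1]%R &
  forall t, t \in `[0, 1]%R -> `|g t| <= `|g c|.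
  apply: (@EVT_max _ (fun t => `|g t|)) => //.
  by apply: continuous_subspaceT => t; apply: cvg_norm; exact: cg.
set M := `|g c| in cM.
have M0 : 0 <= M by exact: normr_ge0.
(* [N2] makes the jump term small: the bad set will have measure at most [2 * q] with [q] at most
   [2 ^- N2], and [g] varies by at most [2 * M] on [0, 1]. *)
have [N2 N2P] : exists N, 2 ^- N * (4 * (M + 1)) < e / 4.
  have p0 : 0 < e / 4 / (4 * (M + 1))
    by rewrite !divr_gt0// mulr_gt0// ltr_wpDl.
  have [N _ /(_ N (leqnn _)) /=] := @near_infty_natSinv_expn_lt R (PosNum p0).
  by rewrite div1r ltr_pdivlMr// ?mulr_gt0// ?ltr_wpDl//; exists N.
pose N := maxn N1 N2.
have NN1 : 2 ^- N <= 2 ^- N1 :> R.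
  by rewrite lef_pV2 ?posrE ?exprn_gt0// ler_weXn2l ?leq_maxl// ler1n.
have NN2 : 2 ^- N <= 2 ^- N2 :> R.
  by rewrite lef_pV2 ?posrE ?exprn_gt0// ler_weXn2l ?leq_maxr// ler1n.
pose q : R := 2 ^- N.
have q0 : 0 < q by rewrite invr_gt0 exprn_gt0.
pose bad := `[0, q[%classic `|` `[1 - q, 1[%classic : set R.
have mbad : measurable bad by apply: measurableU; exact: measurable_itv.
(* One term for each error: the distance from [psi] to [g], the oscillation of [g] over short
   distances, and its jump across the endpoint; each integrates to at most [e / 4]. *)
pose r (x : I) : R :=
  `|psi x - g (circle_val x)| + (e / 4 + 2 * M * \1_bad (circle_val x)).
have mg : measurable_fun [set: R] g by exact: continuous_measurable_fun.
have mv := @measurable_circle_valE R.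
have mpg : measurable_fun [set: I] (fun x => `|psi x - g (circle_val x)|).
  apply: measurableT_comp => //; apply: measurable_funB; first by case: bpsi.
  exact: (measurableT_comp mg).
have mi : measurable_fun [set: I] (fun x => \1_bad (circle_val x) : R).
  by apply: (measurableT_comp _ mv); exact: measurable_indic.
have M20 : 0 <= 2 * M by rewrite mulr_ge0.
have mi2 : measurable_fun [set: I] (fun x => 2 * M * \1_bad (circle_val x) : R).
  exact: measurable_funM.
have mr : measurable_fun [set: I] r.
  by apply: measurable_funD => //; apply: measurable_funD.
exists N, r; split => //.
- by move=> x; rewrite !addr_ge0 ?mulr_ge0// ltW.
- have ibad : (\int[mu]_x (\1_bad (circle_val x))%:E <= (2 * q)%:E)%E.
    rewrite (ge0_integral_circle (f := fun t => (\1_bad t)%:E)); last 2 first.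
    - by apply/measurable_EFinP; exact: measurable_indic.
    - by move=> t; rewrite lee_fin.
    rewrite integral_indic//.
    rewrite (le_trans (le_measure _ _ _ (@subIsetl _ _ _)))// ?inE//.
      by apply: measurableI => //; exact: measurable_itv.
    rewrite (le_trans (measureU2 _ _ _))//; [exact: measurable_itv..|].
    rewrite /= !lebesgue_measure_itv /= !lte_fin q0 gtrBl q0.
    by rewrite -!EFinB -EFinD lee_fin; lra.
  rewrite /r ge0_integral_EFinD//; last 2 first.
  - exact: measurable_funD.
  - by move=> x; rewrite addr_ge0 ?mulr_ge0// ltW.
  rewrite ge0_integral_EFinD//; last 2 first.
  - by move=> x; rewrite ltW.
  - by move=> x; rewrite mulr_ge0.
  rewrite [X in (_ + (X + _))%E]integral_cst//.
  rewrite [X in (_ * X + _)%E](_ : _ = 1%E) ?mule1; last first.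
    exact: probability_setT.
  under [X in (_ + (_ + X))%E]eq_integral do rewrite EFinM.
  rewrite ge0_integralZl//; last exact/measurable_EFinP.
  have /le_lt_trans : (\int[mu]_x `|psi x - g (circle_val x)|%:E + ((e / 4)%:E +
     (2 * M)%:E * \int[mu]_x (\1_bad (circle_val x))%:E) <=
     (e / 4)%:E + ((e / 4)%:E + (2 * M)%:E * (2 * q)%:E))%E.
    by apply: leeD; [exact: ltW | apply: leeD2l; apply: lee_wpmul2l].
  apply; rewrite -!EFinM -!EFinD lte_fin.
  have : 2 * M * (2 * q) <= 2 ^- N2 * (4 * (M + 1)).
    have -> : 2 * M * (2 * q) = q * (4 * M) by ring.
    by apply: ler_pM => //; [exact: ltW | exact: mulr_ge0 | lra].
  lra.
move=> x y xy; rewrite /r.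
have vx := circle_valP x; have vy := circle_valP y.
set s := circle_val x in vx *; set t := circle_val y in vy *.
have px : psi x - g s <= `|psi x - g s| by exact: ler_norm.
have px' : - (psi x - g s) <= `|psi x - g s| by rewrite -normrN ler_norm.
have py : psi y - g t <= `|psi y - g t| by exact: ler_norm.
have i0 u : 0 <= 2 * M * \1_bad u by rewrite mulr_ge0.
have is0 := i0 s; have it0 := i0 t.
have [st|st] := ltP `|s - t| q.
  have := N1P s t => /(_ _ (lt_le_trans st NN1)).
  have -> : 0 <= s <= 1 by lra.
  move=> /(_ isT); rewrite distrC => gst; have := ler_norm (g t - g s); lra.
(* Here the points are at least [q] apart on the line but less than [q] apart on the circle, so [s]
   is within [q] of an end of [0, 1). *)
have bs : \1_bad s = 1 :> R.
  rewrite indicE mem_set// /bad /= !in_itv /=.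
  move: xy; rewrite /dist_circle -/s -/t gt_min ltNge st /= => st1.
  have [ts|ts] := lerP t s.
    by rewrite ger0_norm ?subr_ge0// in st1; right; rewrite -/q in st1; lra.
  by rewrite ltr0_norm ?subr_lt0// in st1; left; rewrite -/q in st1; lra.
have s01 : s \in `[0, 1]%R by rewrite in_itv /=; lra.
have t01 : t \in `[0, 1]%R by rewrite in_itv /=; lra.
have := cM _ s01; have := cM _ t01; rewrite bs mulr1 !ler_norml.
lra.
Qed.

End Approximation.

(** * Lower bound for the primal value *)

Section Marginals.
Context {R : realType}.
Context {d1 d2 : measure_display} {X : measurableType d1}.
Context {Y : measurableType d2}.
Variables (m1 : {measure set X -> \bar R}) (m2 : {measure set Y -> \bar R}).
Variable p : probability (X * Y)%type R.
Hypothesis plan : transport_plan m1 m2 p.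

Lemma ge0_integral_marginal1 (f : X -> \bar R) : measurable_fun [set: X] f ->
  (forall x, 0 <= f x)%E -> (\int[p]_z f z.1 = \int[m1]_x f x)%E.
Proof.
move=> mf f0.
rewrite -[LHS](ge0_integral_image_measure p (@measurable_fst _ _ X Y)
  (D := setT))//.
by apply: eq_measure_integral => A mA _; have [+ _] := plan; exact.
Qed.

Lemma ge0_integral_marginal2 (f : Y -> \bar R) : measurable_fun [set: Y] f ->
  (forall x, 0 <= f x)%E -> (\int[p]_z f z.2 = \int[m2]_x f x)%E.
Proof.
move=> mf f0.
rewrite -[LHS](ge0_integral_image_measure p (@measurable_snd _ _ X Y)
  (D := setT))//.
by apply: eq_measure_integral => A mA _; have [_ +] := plan; exact.
Qed.

(** Boundedness makes both terms integrable against the plan, so the integral splits; positive and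
    negative parts then pass to the marginals separately. *)
Lemma integral_plan_sum (f : X -> R) (g : Y -> R) :
  measurable_fun [set: X] f -> measurable_fun [set: Y] g ->
  (exists M, forall x, `|f x| <= M) -> (exists M, forall y, `|g y| <= M) ->
  (\int[p]_z (f z.1 + g z.2)%:E =
   \int[m1]_x (f x)%:E + \int[m2]_y (g y)%:E)%E.
Proof.
move=> mf mg [M fM] [K gK].
have mf1 : measurable_fun [set: X * Y] (f \o fst) by exact: measurableT_comp.
have mg2 : measurable_fun [set: X * Y] (g \o snd) by exact: measurableT_comp.
have if1 : p.-integrable setT (EFin \o (f \o fst)).
  apply: measurable_bounded_integrable => //.
    exact: (le_lt_trans (probability_le1 p measurableT) (ltry 1)).
  exists M; split; first by rewrite num_real.
  by move=> L ML t _ /=; rewrite (le_trans (fM _))// ltW.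
have ig2 : p.-integrable setT (EFin \o (g \o snd)).
  apply: measurable_bounded_integrable => //.
    exact: (le_lt_trans (probability_le1 p measurableT) (ltry 1)).
  exists K; split; first by rewrite num_real.
  by move=> L ML t _ /=; rewrite (le_trans (gK _))// ltW.
under [LHS]eq_integral do rewrite EFinD.
rewrite [LHS]integralD//.
rewrite [in LHS]integralE [X in (_ + X)%E]integralE.
rewrite [X in (_ = X + _)%E]integralE [X in (_ = _ + X)%E]integralE.
have mfE : measurable_fun [set: X] (EFin \o f) by exact/measurable_EFinP.
have mgE : measurable_fun [set: Y] (EFin \o g) by exact/measurable_EFinP.
rewrite -(ge0_integral_marginal1 (f := (EFin \o f)^\+%E))//;
  last exact: measurable_funepos.
rewrite -(ge0_integral_marginal1 (f := (EFin \o f)^\-%E))//;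
  last exact: measurable_funeneg.
rewrite -(ge0_integral_marginal2 (f := (EFin \o g)^\+%E))//;
  last exact: measurable_funepos.
rewrite -(ge0_integral_marginal2 (f := (EFin \o g)^\-%E))//;
  last exact: measurable_funeneg.
by congr (_ - _ + (_ - _))%E; apply: eq_integral => z _;
  rewrite ?funeposE ?funenegE.
Qed.

End Marginals.

Section LowerBound.
Variable R : realType.
Local Notation I := (borel (circle R)).
Local Notation mu := (lebesgue_circle (R := R)).
Local Notation rot := Defs.rot.
Implicit Types (x y : I) (pi : probability (I * I)%type R).

Variables (alpha : R) (tau : nat -> I -> int).
Hypothesis irr : irrational alpha.
Hypothesis tau0 : forall x, tau 0%N x = 0.
Hypothesis tau1 : forall x, tau 1%N x = 1.
Hypothesis mT : forall n, measurable_fun [set: I] (rot_by alpha (tau n)).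
Hypothesis potentials : approximate_potentials alpha tau.
Hypothesis near_id : near_identity alpha tau.
Local Notation T n := (rot_by alpha (tau n)).

Lemma rot_zero x : rot alpha 0 x = x.
Proof. by rewrite /rot /oplus mul0r addr0 frac_circle_val. Qed.

Lemma rot_by_tau0 x : T 0%N x = x.
Proof. by rewrite /rot_by tau0 rot_zero. Qed.

Lemma cost_along0 x : cost_along alpha (tau 0%N) x = 1%E.
Proof.
by rewrite /cost_along /rot_by tau0 hcost_rot// /varrho /= addr0 subr0.
Qed.

(* Up to L^1-errors [p] and [q], the potentials form an admissible pair for [h]
   on the graphs indexed by [s], and are dominated by 1 on all far graphs:
   these are close to the diagonal, where [h] equals 1. *)
Definition almost_dual (s : seq nat) (N : nat) : Prop :=
  exists (phi psi : I -> R) (p q : I -> \bar R),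
  [/\ bounded_borel phi /\ bounded_borel psi,
    [/\ measurable_fun [set: I] p, measurable_fun [set: I] q,
      (forall x, 0 <= p x)%E & (forall y, 0 <= q y)%E],
    ((3 / 4)%:E < \int[mu]_x (phi x)%:E + \int[mu]_y (psi y)%:E)%E /\
    (\int[mu]_x p x + \int[mu]_y q y <= (1 / 4)%:E)%E,
    forall n x, n \in s ->
      ((phi x + psi (T n x))%:E <=
        cost_along alpha (tau n) x + (p x + q (T n x)))%E &
    forall n x, (N <= n)%N ->
      ((phi x + psi (T n x))%:E <= 1 + (p x + q (T n x)))%E].

(** A single index [m] of the potentials serves. The errors on the graphs of [s] and on the diagonal
    go into [p]; by [L1_modulus] a far graph adds only [r x] and [r (T n x)] to the bound on the
    diagonal. *)
Lemma almost_dual_ex s : exists N, almost_dual s N.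
Proof.
have [phi [psi [bb cvg0 cvg1]]] := potentials.
pose D m n x := `|cost_along alpha (tau n) x - (phi m x + psi m (T n x))%:E|%E.
have D0 m n x : (0 <= D m n x)%E by exact: abse_ge0.
have mD m n : measurable_fun [set: I] (D m n).
  apply: measurableT_comp => //; apply: emeasurable_funB.
    exact: measurable_cost_along.
  apply/measurable_EFinP; have [[mphi _] [mpsi _]] := bb m.
  by apply: measurable_funD => //; exact: (measurableT_comp mpsi).
pose S m t x := (\sum_(n <- t) D m n x)%E.
have mS m t : measurable_fun [set: I] (S m t) by exact: emeasurable_sum.
have S0 m t x : (0 <= S m t x)%E by exact: sume_ge0.
have cvgS t (e : R) : 0 < e ->
  \forall m \near \oo, (\int[mu]_x S m t x < e%:E)%E.
  elim: t e => [|n t IH] e e0.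
    near=> m; rewrite (_ : S m [::] = cst 0%E) ?integral0 ?lte_fin//.
    by apply/funext => x; rewrite /S big_nil.
  have e2 : 0 < e / 2 by rewrite divr_gt0.
  near=> m.
  have -> : S m (n :: t) = (fun x => D m n x + S m t x)%E.
    by apply/funext => x; rewrite /S big_cons.
  rewrite ge0_integralD//.
  have -> : e%:E = ((e / 2)%:E + (e / 2)%:E)%E by rewrite -EFinD -splitr.
  apply: lteD; last by near: m; exact: IH.
  have <- := Lnorm1 mu (fun x => cost_along alpha (tau n) x -
      (phi m x + psi m (rot_by alpha (tau n) x))%R%:E)%E.
  near: m; apply: (cvg0 n [set u | (u < (e / 2)%:E)%E]).
  by apply: open_ereal_lt'; rewrite lte_fin.
have e16 : 0 < 1 / 16 :> R by rewrite divr_gt0.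
(* The index 0 is added to [s] because the far graphs are compared with the diagonal. *)
have [m [Sm phipsi]] : exists m,
    (\int[mu]_x S m (0%N :: s) x < (1 / 16)%:E)%E /\
    ((3 / 4)%:E < \int[mu]_x (phi m x)%:E + \int[mu]_y (psi m y)%:E)%E.
  have : \forall m \near \oo, (\int[mu]_x S m (0%N :: s) x < (1 / 16)%:E)%E /\
    ((3 / 4)%:E < \int[mu]_x (phi m x)%:E + \int[mu]_y (psi m y)%:E)%E.
    near=> m; split; near: m; first exact: cvgS.
    apply: (cvg1 [set u | ((3 / 4)%:E < u)%E]).
    by apply: open_ereal_gt'; rewrite lte_fin; lra.
  by case=> m _ /(_ m (leqnn m)); exists m.
have [bphi bpsi] := bb m.
have [N [r [mr r0 rlt rP]]] := L1_modulus bpsi e16.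
(* Taking [N.+1] rather than [N] forces far indices to be at least 1, as [near_identity] demands. *)
exists N.+1, (phi m), (psi m).
exists (fun x => S m (0%N :: s) x + (r x)%:E)%E, (fun y => (r y)%:E).
have DS n x : n \in (0%N :: s) -> (D m n x <= S m (0%N :: s) x)%E.
  by move=> ns; rewrite /S (big_rem n)//= leeDl// sume_ge0.
have Dle n x : ((phi m x + psi m (T n x))%:E <=
    cost_along alpha (tau n) x + D m n x)%E.
  have := cost_along_fin_num irr (tau n) x.
  rewrite /D; case: (cost_along _ _ _) => // a _;
    rewrite -EFinB /= -EFinD lee_fin.
  by have := ler_norm (phi m x + psi m (T n x) - a); rewrite distrC; lra.
split=> //.
- split=> //.
  + by apply: emeasurable_funD => //; exact/measurable_EFinP.
  + exact/measurable_EFinP.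
  + by move=> x; rewrite adde_ge0// lee_fin.
- split=> //.
  rewrite ge0_integralD//; last 2 first.
  + by move=> x _; rewrite lee_fin.
  + exact/measurable_EFinP.
  have -> : (1 / 4)%:E = ((1 / 16)%:E + (1 / 16)%:E + (1 / 8)%:E :> \bar R)%E.
    by rewrite -!EFinD; congr EFin; lra.
  apply: leeD; first by apply: leeD; exact: ltW.
  by apply: (le_trans (ltW rlt)); rewrite lee_fin; lra.
- move=> n x ns; apply: (le_trans (Dle n x)); apply: leeD2l.
  apply: (le_trans (DS n x _)); first by rewrite inE ns orbT.
  by rewrite -addeA leeDl// -EFinD lee_fin addr_ge0.
move=> n x Nn.
have := Dle 0%N x; rewrite cost_along0 rot_by_tau0 => D0x.
have := DS 0%N x (mem_head _ _) => DS0.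
have psin : psi m (T n x) <= psi m x + r x + r (T n x).
  apply: rP; apply: (lt_le_trans (near_id _ _)); first exact: leq_ltn_trans Nn.
  by rewrite lef_pV2 ?posrE ?exprn_gt0// ler_weXn2l ?ler1n// ltnW.
have -> : (1 + (S m (0%N :: s) x + (r x)%:E + (r (T n x))%:E) =
    1 + S m (0%N :: s) x + ((r x)%:E + (r (T n x))%:E))%E by rewrite !addeA.
apply: (@le_trans _ _ ((phi m x + psi m x)%:E + (r x + r (T n x))%:E)%E).
  by rewrite -EFinD lee_fin; lra.
apply: leeD => //; apply: (le_trans D0x); exact: leeD2l.
Unshelve. all: by end_near.
Qed.

Section Plan.
Variable i : nat -> nat.
Local Notation c := (cost alpha tau i).
Local Notation graph n := [set z : I * I | z.2 = T n z.1].

(** [iota 2 J.-1] runs over 2, ..., J, so the list is 0, 1, i_2, ..., i_J. *)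
Let head J : seq nat := [:: 0, 1 & [seq i k | k <- iota 2 J.-1]]%N.

Let heads J : set (I * I) := \bigcup_(n in [set` head J]) graph n.

(** The rest of the carrier, not the union of the later graphs: a point of a later graph may also
    lie on an earlier one, and such points must go if the sets are to decrease to the empty set. *)
Let tail J : set (I * I) :=
  [set z | on_graphs alpha tau i z.1 z.2] `\` heads J.

Let mheads J : measurable (heads J).
Proof.
by apply: bigcup_measurable => n _; exact: measurable_graph.
Qed.

Let mtail J : measurable (tail J).
Proof. by apply: measurableD => //; exact: measurable_on_graphs. Qed.

Lemma cost_graph n z : on_graphs alpha tau i z.1 z.2 -> z.2 = T n z.1 ->
  (cost_along alpha (tau n) z.1 <= c z)%E.
Proof.
move=> oz zT; rewrite /cost; case: pselect => // ?.
by rewrite /cost_along -zT le_max lexx.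
Qed.

Lemma on_graphs_cases z : on_graphs alpha tau i z.1 z.2 ->
  exists2 n, z.2 = T n z.1 &
    [\/ n = 0%N, n = 1%N | exists2 j, (2 <= j)%N & n = i j].
Proof.
case=> [z0|z1|[j j2 zj]].
- by exists 0%N; [rewrite /rot_by tau0 | constructor 1].
- by exists 1%N; [rewrite /rot_by tau1 | constructor 2].
- by exists (i j) => //; constructor 3; exists j.
Qed.

Let head_mem J j : (2 <= j <= J)%N -> i j \in head J.
Proof.
move=> /andP[j2 jJ]; rewrite !inE (map_f i) ?orbT//.
by rewrite mem_iota j2 /=; case: J jJ => [|J] jJ; lia.
Qed.

(** Every point of the carrier lies on a graph whose index enters [head J] at a finite stage, so the
    tails decrease to the empty set; continuity from above of the finite measure [pi] concludes. *)
Let tail_cvg0 pi : pi (tail J) @[J --> \oo] --> 0%E.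
Proof.
have tail0 : \bigcap_J tail J = set0.
  apply/seteqP; split=> // z tz.
  have [/= /on_graphs_cases[n zT ncase] _] := tz 0%N Logic.I.
  have [J nJ] : exists J, n \in head J.
    case: ncase => [->|->|[j j2 ->]].
    - by exists 0%N; rewrite !inE.
    - by exists 0%N; rewrite !inE.
    - by exists j; apply: head_mem; rewrite j2 /=.
  by have [_] := tz J Logic.I; apply; exists n.
rewrite -(measure0 pi) -tail0.
apply: nonincreasing_cvg_mu => //.
- exact: (le_lt_trans (probability_le1 pi _) (ltry 1)).
- exact: bigcap_measurable.
move=> J K JK; apply/subsetPset => z [oz nh]; split=> // -[n /= nJ zT];
  apply: nh.
exists n => //=; move: nJ; rewrite /head !inE => /orP[->//|/orP[->|]].
  by rewrite orbT.
move=> /mapP[k + ->]; rewrite mem_iota => /andP[k2 kJ].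
by have := @head_mem K k; rewrite /head !inE; apply; rewrite k2 /=; lia.
Qed.

(** The cutoff [J] is chosen after the plan, yet the bound is uniform because the constants in
    [almost_dual] are the same for every list. Integrating the majorant [U] shows that 3/4 is less
    than the cost plus 1/4 for the tail plus 1/4 for the errors. *)
Lemma plan_cost_ge (N : seq nat -> nat) pi :
  (forall s, almost_dual s (N s)) ->
  (forall j k, (2 <= j)%N -> (j < k)%N ->
    (N [:: 0, 1 & [seq i k | k <- iota 2 j.-1]] <= i k)%N) ->
  transport_plan mu mu pi -> ((1 / 4)%:E <= \int[pi]_z c z)%E.
Proof.
move=> dualN fast plan.
have [J J2 tailJ] : exists2 J, (2 <= J)%N & (pi (tail J) < (1 / 4)%:E)%E.
  have := @tail_cvg0 pi [set u | (u < (1 / 4)%:E)%E].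
  case; first by apply: open_ereal_lt'; rewrite lte_fin divr_gt0.
  by move=> J _ JP; exists (maxn 2 J); [exact: leq_maxl | apply: JP;
    exact: leq_maxr].
have [phi [psi [p [q [[[mphi bphi] [mpsi bpsi]] [mp mq p0 q0] [gt34 le14]
  near far]]]]] := dualN (head J).
have mc : measurable_fun [set: I * I] c by exact: measurable_cost.
have c0 := cost_ge0 alpha tau i.
pose U z := (c z + ((\1_(tail J) z)%:E + (p z.1 + q z.2)))%E.
have mp1 : measurable_fun [set: I * I] (fun z => p z.1)
  by exact: measurableT_comp.
have mq2 : measurable_fun [set: I * I] (fun z => q z.2)
  by exact: measurableT_comp.
have m1 : measurable_fun [set: I * I] (fun z => (\1_(tail J) z)%:E : \bar R).
  by apply/measurable_EFinP; exact: measurable_indic.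
have mpq : measurable_fun [set: I * I] (fun z => p z.1 + q z.2)%E
  by exact: emeasurable_funD.
have pq0 z : (0 <= p z.1 + q z.2)%E by exact: adde_ge0.
have mU2 : measurable_fun [set: I * I]
    (fun z => (\1_(tail J) z)%:E + (p z.1 + q z.2))%E.
  exact: emeasurable_funD.
have U20 z : (0 <= (\1_(tail J) z)%:E + (p z.1 + q z.2))%E.
  by apply: adde_ge0 => //; rewrite lee_fin.
have mU : measurable_fun [set: I * I] U by exact: emeasurable_funD.
have leU z : ((phi z.1 + psi z.2)%:E <= U z)%E.
  rewrite /U.
  have [oz|noz] := pselect (on_graphs alpha tau i z.1 z.2); last first.
    by rewrite /cost; case: pselect => // ?;
      rewrite addye ?leey// gt_eqF// (lt_le_trans ltNy0 (U20 z)).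
  have [n zT ncase] := on_graphs_cases oz.
  have [nJ|nJ] := boolP (n \in head J).
    rewrite {1}zT; apply: (le_trans (near n z.1 nJ)); rewrite -zT.
    apply: leeD; first exact: cost_graph.
    by apply: leeDr; rewrite lee_fin.
  (* Although [n] is not in the head list, [z] may lie on another graph that is; outside the tail
     this must be so. *)
  have [tz|] := pselect (tail J z); last first.
    move=> ntz; have [m mJ zTm] : heads J z.
      by apply: contrapT => nh; apply: ntz.
    rewrite {1}zTm; apply: (le_trans (near m z.1 mJ)); rewrite -zTm.
    apply: leeD; first exact: cost_graph.
    by apply: leeDr; rewrite lee_fin.
  rewrite indicE mem_set// {1}zT.
  apply: (@le_trans _ _ (1 + (p z.1 + q (T n z.1)))%E).
    (* An index outside the head is some [i j] with [j > J], and the growth hypothesis puts it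
       beyond [N (head J)]. *)
    apply: far; case: ncase nJ => [->|->|[j j2 ->]]; rewrite ?inE//.
    move=> ij; apply: fast => //; rewrite ltnNge; apply: contra ij => jJ.
    by apply: head_mem; rewrite j2.
  by rewrite -zT leeDr.
have : (\int[pi]_z (phi z.1 + psi z.2)%:E <= \int[pi]_z U z)%E.
  (* The integrand on the left has no sign, so its positive part is compared with [U]. *)
  rewrite [leLHS]integralE; apply: (@le_trans _ _
      (\int[pi]_z ((fun z : I * I => (phi z.1 + psi z.2)%:E)^\+%E z))%E).
    by rewrite -[leRHS]sube0; apply: leeB => //; exact: integral_ge0.
  apply: ge0_le_integral => //.
  - apply: measurable_funepos; apply/measurable_EFinP; apply: measurable_funD.
      exact: (measurableT_comp mphi).
    exact: (measurableT_comp mpsi).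
  - by move=> z _; rewrite funeposE ge_max leU /= /U adde_ge0.
rewrite (integral_plan_sum plan)//.
rewrite ge0_integralD//.
rewrite ge0_integralD//.
rewrite ge0_integralD//.
rewrite (ge0_integral_marginal1 plan)// (ge0_integral_marginal2 plan)//.
rewrite integral_indic// setIT => le34.
rewrite leNgt; apply/negP => lt14.
have := lt_le_trans gt34 le34; apply/negP; rewrite -leNgt.
have -> : (3 / 4)%:E = ((1 / 4)%:E + ((1 / 4)%:E + (1 / 4)%:E) :> \bar R)%E.
  by rewrite -!EFinD; congr EFin; lra.
by apply: leeD; [exact: ltW | apply: leeD => //; exact: ltW].
Qed.

End Plan.
End LowerBound.

(** * The relaxed and dual values *)

Lemma integral_mrestr {R : realType} {d} {X : measurableType d}
    (m : {measure set X -> \bar R}) (A : set X) (mA : measurable A)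
    (f : X -> \bar R) :
  (forall x, 0 <= f x)%E -> measurable_fun [set: X] f ->
  (\int[mrestr m mA]_x f x = \int[m]_(x in A) f x)%E.
Proof.
move=> f0 mf; rewrite [LHS](ge0_negligible_integral (N := ~` A))//;
  last 2 first.
- exact: measurableC.
- by rewrite /= /mrestr setICl measure0.
rewrite setTD setCK; apply: eq_measure_integral => B mB BA.
by rewrite /= /mrestr setIidl.
Qed.

(** The excess of |phi| over [n] tends to 0 wherever [phi] is finite, hence almost everywhere, and
    is dominated by |phi|. *)
Lemma integrable_trunc {R : realType} {d} {X : measurableType d}
    (m : {measure set X -> \bar R}) (phi : X -> \bar R) (e : R) :
  m.-integrable [set: X] phi -> 0 < e ->
  exists2 K : R, 0 <= K & (\int[m]_x maxe (`|phi x| - K%:E) 0 < e%:E)%E.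
Proof.
move=> iphi e0; have [mphi _] := integrableP _ _ _ iphi.
have mabs : measurable_fun [set: X] (fun x => `|phi x|%E)
  by exact: measurableT_comp.
pose f_ (n : nat) x := (maxe (`|phi x| - n%:R%:E) 0)%E.
have mf_ n : measurable_fun [set: X] (f_ n).
  by apply: measurable_maxe => //; apply: emeasurable_funB.
have [||||] := @dominated_convergence _ _ _ m setT measurableT f_ (cst 0%E)
  (abse \o phi) mf_.
- exact: measurable_cst.
- have := integrable_ae measurableT iphi;
  apply: filterS => x /(_ Logic.I) phix _.
  apply: cvg_near_cst; have [N _ NP] := nbhs_infty_ger (fine `|phi x|%E).
  exists N => // n /= Nn; apply/eqP; rewrite /f_ eq_maxr.
  have {}NP := NP n Nn; rewrite leeBlDr// add0e -(@fineK _ `|phi x|%E)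
    ?lee_fin//.
  by rewrite abse_fin_num.
- exact: integrable_abse.
- apply: aeW => x n _; rewrite /f_ /= gee0_abs ?le_max ?lexx ?orbT//.
  by rewrite ge_max abse_ge0 andbT -[leRHS]adde0 leeD2l// lee_fin oppr_le0.
move=> _ _ /(_ [set u | (u < e%:E)%E]); rewrite integral_cst// mul0e.
case; first by apply: open_ereal_lt'; rewrite lte_fin.
by move=> N _ /(_ N (leqnn N)); exists N%:R.
Qed.

Section UpperBounds.
Variable R : realType.
Local Notation I := (borel (circle R)).
Local Notation mu := (lebesgue_circle (R := R)).
Implicit Types (x y : I).

Lemma ge0_integral_preserving (T : I -> I) (f : I -> \bar R) :
  measure_preserving T -> measurable_fun [set: I] f -> (forall x, 0 <= f x)%E ->
  (\int[mu]_x f (T x) = \int[mu]_x f x)%E.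
Proof.
move=> [mT Tmu] mf f0.
rewrite -[LHS](ge0_integral_image_measure mu mT (D := setT))//.
by apply: eq_measure_integral => A mA _; exact: Tmu.
Qed.

Lemma integrable_preserving (T : I -> I) (f : I -> \bar R) :
  measure_preserving T -> mu.-integrable [set: I] f ->
  mu.-integrable [set: I] (f \o T).
Proof.
move=> pT /integrableP[mf foo]; apply/integrableP; split.
  by apply: measurableT_comp mf _; case: pT.
rewrite (ge0_integral_preserving (f := abse \o f))//.
  exact: measurableT_comp.
by move=> x; exact: abse_ge0.
Qed.

Lemma integral_preserving (T : I -> I) (f : I -> \bar R) :
  measure_preserving T -> mu.-integrable [set: I] f ->
  (\int[mu]_x f (T x) = \int[mu]_x f x)%E.
Proof.
move=> pT /integrableP[mf _]; rewrite [LHS]integralE [RHS]integralE.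
rewrite -(ge0_integral_preserving pT (measurable_funepos mf))//.
rewrite -(ge0_integral_preserving pT (measurable_funeneg mf))//.
by congr (_ - _)%E; apply: eq_integral => x _; rewrite ?funeposE ?funenegE.
Qed.

Variables (alpha : R) (tau : nat -> I -> int).
Hypothesis irr : irrational alpha.
Hypothesis pT : forall n, measure_preserving (rot_by alpha (tau n)).
Hypothesis concentrated : concentrated_costs alpha tau.
Local Notation T n := (rot_by alpha (tau n)).

Let mT n : measurable_fun [set: I] (T n). Proof. by case: (pT n). Qed.

(** On the zero set of [g n] the cost equals its deviation from [g n], of L^1-norm below [2 ^- n],
    and the complement has measure [eta n]. *)
Lemma small_cost_set (e : R) : 0 < e -> exists N, forall n, (N <= n)%N ->
  exists A : set I, [/\ measurable A, (mu (~` A) <= e%:E)%E &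
    (\int[mu]_(x in A) maxe (cost_along alpha (tau n) x) 0 <= e%:E)%E].
Proof.
move=> e0; have [eta [g [cvgeta gP]]] := concentrated.
have [N1 _ N1P] := @cvgr_lt _ _ _ _ _ _ cvgeta _ e0.
have [N2 _ N2P] := @near_infty_natSinv_expn_lt R (PosNum e0).
(* [concentrated_costs] starts at 1; [N1] controls [eta n] and [N2] controls [2 ^- n]. *)
exists (maxn 1 (maxn N1 N2)) => n; rewrite !geq_max => /and3P[n1 nN1 nN2].
have [mg mu0 _ fg] := gP n n1.
pose A : set I := [set x | g n x = 0].
have mA : measurable A.
  by have := mg measurableT [set 0] (measurable_set1 0); rewrite setTI.
exists A; split=> //.
  have -> : mu (~` A) = (eta n)%:E.
    rewrite (@probability_setC _ _ _ mu)// [X in (1 - X)%E]mu0 -EFinB.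
    by rewrite opprB addrC subrK.
  by rewrite lee_fin ltW// N1P.
have mf := measurable_cost_along irr (mT n).
pose d x := `|(cost_along alpha (tau n) x - (g n x)%:E)%E|%E.
have mfg : measurable_fun [set: I] d.
  apply: measurableT_comp => //; apply: emeasurable_funB => //.
  exact/measurable_EFinP.
apply: (@le_trans _ _ (\int[mu]_(x in A) d x)%E).
  apply: ge0_le_integral => //.
  - by move=> x _; rewrite le_max lexx orbT.
  - by apply: measurable_funTS; exact: measurable_maxe.
  - exact: measurable_funTS.
  - by move=> x /= gx; rewrite /d gx sube0 ge_max lee_abs abse_ge0.
apply: (@le_trans _ _ (2 ^- n)%:E).
  apply: le_trans (ltW fg); rewrite Lnorm1.
  apply: ge0_subset_integral => // x _; exact: abse_ge0.
by rewrite lee_fin ltW// -div1r N2P.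
Qed.

Variable i : nat -> nat.
Hypothesis i_inc : forall j, (2 <= j)%N -> (i j < i j.+1)%N.
Local Notation c := (cost alpha tau i).

Lemma index_unbounded N : exists2 j, (2 <= j)%N & (N <= i j)%N.
Proof.
exists (N + 2)%N; first by rewrite leq_addl.
elim: N => // N IH; rewrite addSn; apply: leq_ltn_trans IH (i_inc _).
by rewrite leq_addl.
Qed.

Lemma cost_on_graph j x : (2 <= j)%N ->
  (c (x, T (i j) x) = maxe (cost_along alpha (tau (i j)) x) 0)%E.
Proof.
move=> j2; rewrite /cost; case: pselect => //= -[].
by constructor 3; exists j.
Qed.

Let mc : measurable_fun [set: I * I] c.
Proof. exact: measurable_cost. Qed.

Let mpair n : measurable_fun [set: I] (fun x => (x, T n x)).
Proof. by apply: measurable_fun_pair. Qed.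

(** Transport the set [A] of [small_cost_set] along a far graph: what is left out has measure at
    most [eps], and the second marginal is at most [mu] because the map preserves [mu]. *)
Lemma primal_eps_eq0 eps : 0 < eps -> primal_eps mu mu c eps = 0%E.
Proof.
move=> eps0; apply/eqP; rewrite eq_le; apply/andP; split; last first.
  by apply: le_ereal_inf_tmp => _ [pi _ ->]; apply: integral_ge0 => z _;
    exact: cost_ge0.
apply/lee_addgt0Pr => e e0; rewrite add0e.
(* The minimum lets one set [A] meet both the mass requirement and the cost bound. *)
have m0 : 0 < Num.min eps e by rewrite lt_min eps0.
have [N NP] := small_cost_set m0.
have [j j2 Nj] := index_unbounded N.
have [A [mA muA fA]] := NP _ Nj.
pose pi := image_measure (mrestr mu mA) (mpair (i j)).
apply: (@le_trans _ _ (\int[pi]_z c z)%E).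
  apply: ereal_inf_lbound; exists pi => //; split.
  - rewrite /pi image_measureE /= /mrestr preimage_setT setTI.
    have -> : mu A = (1 - mu (~` A))%E.
      by rewrite -(@probability_setC _ _ _ mu) ?setCK//; exact: measurableC.
    rewrite EFinB; apply: leeB => //; apply: (le_trans muA).
    by rewrite lee_fin ge_min lexx.
  - move=> B mB; rewrite /pushforward /pi image_measureE /= /mrestr.
    by apply: le_measure; rewrite ?inE//; exact: measurableI.
  - move=> B mB; rewrite /pushforward /pi image_measureE /= /mrestr.
    have [_ /(_ B mB) <-] := pT (i j).
    have mTB : measurable (T (i j) @^-1` B).
      by rewrite -[X in measurable X]setTI; exact: mT.
    by apply: le_measure; rewrite ?inE//; exact: measurableI.
rewrite ge0_integral_image_measure//; last exact: cost_ge0.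
rewrite preimage_setT
  (eq_integral (fun x => maxe (cost_along alpha (tau (i j)) x) 0)%E).
  rewrite integral_mrestr//; last 2 first.
  - by move=> x; rewrite le_max lexx orbT.
  - by apply: measurable_maxe => //; exact: measurable_cost_along.
  by apply: (le_trans fA); rewrite lee_fin ge_min lexx orbT.
by move=> x _; rewrite cost_on_graph.
Qed.

Lemma primal_rel_eq0 : primal_rel mu mu c = 0%E.
Proof.
apply: cvg_lim => //; apply: cvg_near_cst.
by near=> eps; apply: primal_eps_eq0; near: eps; exact: nbhs_right_gt.
Unshelve. all: by end_near.
Qed.

Hypothesis int1 : forall n, (\int[mu]_x cost_along alpha (tau n) x = 1)%E.

(** An infinite positive part would make the whole integral infinite instead of 1. Finiteness makes
    the plan carried by a graph a legitimate test in [dual_rel]. *)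
Lemma integral_pos_cost n :
  (\int[mu]_x maxe (cost_along alpha (tau n) x) 0 < +oo)%E.
Proof.
rewrite ltey; apply/eqP => foo; have := int1 n; rewrite integralE.
under eq_integral do rewrite funeposE; rewrite foo.
by case: (\int[mu]_x _)%E.
Qed.

Lemma le_trunc (a : \bar R) (K : R) : (a <= K%:E + maxe (`|a| - K%:E) 0)%E.
Proof.
case: a => [a| |] /=; last exact: leNye.
- rewrite -EFinB -EFin_max -EFinD lee_fin.
  have := ler_norm a; have : `|a| - K <= Num.max (`|a| - K) 0
    by rewrite le_max lexx.
  lra.
- by rewrite addye// /maxe ltNge leey /= addey.
Qed.

(** Test a dual pair on the plan carried by the graph of a far map [S]. Since [S] preserves [mu],
    the dual value is the integral of [phi x + psi (S x)]: on [A] the cost bounds it, off [A] the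
    truncation levels do, up to two excesses. *)
Lemma dual_rel_le0 : (dual_rel mu mu c <= 0)%E.
Proof.
apply: ge_ereal_sup => _ [phi [psi [[iphi _] [ipsi _] adm ->]]].
apply/lee_addgt0Pr => e e0; rewrite add0e.
(* The truncation levels come before the graph, so that the complement of [A] can be made small
   relative to [K1 + K2]. *)
have e4 : 0 < e / 4 by rewrite divr_gt0.
have [K1 K10 phiK] := integrable_trunc iphi e4.
have [K2 K20 psiK] := integrable_trunc ipsi e4.
(* The added 1 keeps the divisor positive when both levels are 0. *)
have K0 : 0 < K1 + K2 + 1 by rewrite ltr_wpDl// addr_ge0.
have m0 : 0 < Num.min (e / 4) (e / 4 / (K1 + K2 + 1))
  by rewrite lt_min e4 divr_gt0.
have [N NP] := small_cost_set m0.
have [j j2 Nj] := index_unbounded N.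
have [A [mA muA fA]] := NP _ Nj.
set f := cost_along alpha (tau (i j)) in fA.
set S := T (i j).
have mf : measurable_fun [set: I] f by exact: measurable_cost_along.
have mfp : measurable_fun [set: I] (fun x => maxe (f x) 0)%E
  by exact: measurable_maxe.
pose p := image_probability mu (mpair (i j)).
have plan : transport_plan mu mu p.
  split=> B mB; rewrite /pushforward /p image_probabilityE//.
  exact: (pT (i j)).2.
have pc : (\int[p]_z c z = \int[mu]_x maxe (f x) 0)%E.
  rewrite [LHS](ge0_integral_image_measure mu (mpair (i j)) (D := setT))//;
    last exact: cost_ge0.
  by apply: eq_integral => x _; rewrite cost_on_graph.
have := adm p plan; rewrite pc integral_pos_cost => /(_ isT) [Z [mZ pZ0 ZP]].
have ae : {ae mu, forall x, phi x + psi (S x) <= maxe (f x) 0}%E.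
  exists ((fun x => (x, S x)) @^-1` Z); split => //.
    by rewrite -[X in measurable X]setTI; exact: mpair.
  by move=> x /= nx; apply: ZP => /=; rewrite cost_on_graph.
pose t1 x := (maxe (`|phi x| - K1%:E) 0)%E.
pose t2 x := (maxe (`|psi x| - K2%:E) 0)%E.
have t10 x : (0 <= t1 x)%E by rewrite le_max lexx orbT.
have t20 x : (0 <= t2 x)%E by rewrite le_max lexx orbT.
have [mphi _] := integrableP _ _ _ iphi.
have [mpsi _] := integrableP _ _ _ ipsi.
have mt1 : measurable_fun [set: I] t1.
  apply: measurable_maxe => //; apply: emeasurable_funB => //.
  exact: measurableT_comp.
have mt2 : measurable_fun [set: I] t2.
  apply: measurable_maxe => //; apply: emeasurable_funB => //.
  exact: measurableT_comp.
have mt2S : measurable_fun [set: I] (t2 \o S).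
  exact: (measurableT_comp mt2 (mT (i j))).
pose u x := ((fun x => maxe (f x) 0) \_ A x)%E.
have u0 x : (0 <= u x)%E.
  by rewrite /u patchE; case: ifP => // ?; rewrite le_max lexx orbT.
have m_u : measurable_fun [set: I] u.
  by apply/(measurable_restrictT _ mA); exact: measurable_funTS.
pose v x := ((K1 + K2)%:E * (\1_(~` A) x)%:E)%E.
have K120 : 0 <= K1 + K2 by rewrite addr_ge0.
have v0 x : (0 <= v x)%E by rewrite mule_ge0 ?lee_fin.
have mi : measurable_fun [set: I] (fun x => (\1_(~` A) x)%:E : \bar R).
  by apply/measurable_EFinP; apply: measurable_indic; exact: measurableC.
have mv : measurable_fun [set: I] v by exact: measurable_funeM.
have mtt : measurable_fun [set: I] (fun x => t1 x + t2 (S x))%E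
  by exact: emeasurable_funD.
have tt0 x : (0 <= t1 x + t2 (S x))%E by exact: adde_ge0.
have mvtt : measurable_fun [set: I] (fun x => v x + (t1 x + t2 (S x)))%E
  by exact: emeasurable_funD.
have vtt0 x : (0 <= v x + (t1 x + t2 (S x)))%E by exact: adde_ge0.
have ipsiS := integrable_preserving (pT (i j)) ipsi.
have -> : dual_value mu mu phi psi = (\int[mu]_x (phi x + psi (S x)))%E.
  by rewrite integralD// (integral_preserving (pT (i j)) ipsi).
have [mpsiS _] := integrableP _ _ _ ipsiS.
rewrite integralE; apply: (@le_trans _ _
    (\int[mu]_x ((fun x => phi x + psi (S x))^\+ x))%E).
  by rewrite -[leRHS]sube0; apply: leeB => //; exact: integral_ge0.
(* The majorant is the cost on [A], the constant [K1 + K2] off [A], and the two excesses everywhere;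
   each of the four integrals is at most [e / 4]. *)
apply: (@le_trans _ _ (\int[mu]_x (u x + (v x + (t1 x + t2 (S x)))))%E).
  apply: ae_ge0_le_integral => //.
  - by apply: measurable_funepos; exact: emeasurable_funD.
  - by move=> x _; exact: adde_ge0.
  - exact: emeasurable_funD.
  apply: filterS ae => x fx _; rewrite funeposE ge_max adde_ge0// andbT.
  have [xA|xA] := boolP (x \in A).
    by rewrite /u patchE xA; apply: (le_trans fx); exact: leeDl.
  rewrite /v indicE in_setC xA mule1.
  apply: (@le_trans _ _ ((K1 + K2)%:E + (t1 x + t2 (S x)))%E);
    last exact: leeDr.
  by rewrite EFinD addeACA; apply: leeD; exact: le_trunc.
rewrite ge0_integralD// ge0_integralD// ge0_integralD//.
rewrite (ge0_integral_preserving (pT (i j)) mt2)//.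
rewrite ge0_integralZl// integral_indic//; last exact: measurableC.
rewrite setIT -integral_mkcond.
have -> : e%:E = ((e / 4)%:E + ((e / 4)%:E + ((e / 4)%:E + (e / 4)%:E)))%E.
  by rewrite -!EFinD; congr EFin; lra.
apply: leeD.
  by apply: (le_trans fA); rewrite lee_fin ge_min lexx.
apply: leeD; last by apply: leeD; exact: ltW.
apply: (@le_trans _ _ ((K1 + K2)%:E * (e / 4 / (K1 + K2 + 1))%:E)%E).
  apply: lee_wpmul2l; first by rewrite lee_fin.
  by apply: (le_trans muA); rewrite lee_fin ge_min lexx orbT.
rewrite -EFinM lee_fin mulrA ler_pdivrMr// mulrC ler_pM2l//.
lra.
Qed.

(** A pair admissible everywhere is admissible almost surely for each plan, and the zero pair is
    admissible as the cost is nonnegative; so 0 is at most [dual], which is at most [dual_rel]. *)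
Lemma dual_eq0 : dual mu mu c = 0%E /\ dual_rel mu mu c = 0%E.
Proof.
have le_dual : (dual mu mu c <= dual_rel mu mu c)%E.
  apply: ereal_sup_le => _ [phi [psi [? ? adm ->]]]; exists phi, psi;
    split=> //.
  move=> p _ _; apply: aeW => z; rewrite [z in c z]surjective_pairing;
    exact: adm.
have ge0 : (0 <= dual mu mu c)%E.
  apply: ereal_sup_ubound; exists (cst 0%E), (cst 0%E); split.
  - by split=> [|x]; [exact: integrable0 | exact: ltry].
  - by split=> [|x]; [exact: integrable0 | exact: ltry].
  - by move=> x y; rewrite add0e cost_ge0.
  - by rewrite /dual_value !integral0 adde0.
by split; apply/eqP; rewrite eq_le; apply/andP; split => //;
  [exact: le_trans le_dual dual_rel_le0 | exact: dual_rel_le0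
    | exact: le_trans ge0 le_dual].
Qed.

End UpperBounds.

(** * The circle as a Polish space *)

Section Polish.
Variable R : realType.
Implicit Types (x y : circle R).

Lemma continuous_circle_val : continuous (@circle_val R).
Proof.
apply/continuousP => B oB; rewrite (open_circleE R).
by exists B => //; rewrite setTI.
Qed.

(* The homeomorphism of [0, 1) onto the complete space [1, +oo). *)
Let w (t : R) := (1 - t)^-1.

Let w_continuous x : {for circle_val x, continuous w}.
Proof.
have := circle_valP x => /andP[_ x1].
apply: cvgV; first by rewrite subr_eq0 gt_eqF.
by apply: cvgB; [exact: cvg_cst | exact: cvg_id].
Qed.

Let dist x y : R := `|w (circle_val x) - w (circle_val y)|.

(** The map [w] has slope at least 1 on [0, 1), so it never contracts distances. *)
Let dist_ge x y : `|circle_val x - circle_val y| <= dist x y.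
Proof.
rewrite /dist /w; have := circle_valP x; have := circle_valP y.
set s := circle_val x; set t := circle_val y => t01 s01.
have s1 : 1 - s != 0 by apply/eqP => ?; lra.
have t1 : 1 - t != 0 by apply/eqP => ?; lra.
have -> : (1 - s)^-1 - (1 - t)^-1 = (s - t) / ((1 - s) * (1 - t)).
  by field; rewrite t1 s1.
have p0 : 0 < (1 - s) * (1 - t) by rewrite mulr_gt0; lra.
rewrite normrM normfV (gtr0_norm p0) ler_pdivlMr// ler_piMr//.
by rewrite mulr_ile1; lra.
Qed.

Let dist_nbhs x (A : set (circle R)) : nbhs x A <->
  exists2 e : R, 0 < e & [set y | dist x y < e] `<=` A.
Proof.
split.
  rewrite nbhsE => -[U [+ Ux] UA]; rewrite (open_circleE R) => -[B oB].
  rewrite setTI => BU; move: Ux UA; rewrite -{}BU => Bx BA.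
  have /nbhs_ballP[e /= e0 eB] := open_nbhs_nbhs (conj oB Bx).
  exists e => // y /= xy; apply/BA/eB; rewrite /ball /=.
  exact: le_lt_trans (dist_ge x y) xy.
move=> [e e0 eA]; apply: filterS eA _.
have /cvgrPdist_lt/(_ e e0) := @w_continuous x.
by move/continuous_circle_val.
Qed.

(** The topology is that of [0, 1) in the line, where the usual metric is not complete; [dist] moves
    the missing endpoint 1 to infinity. *)
Lemma polish_circle : polish R (circle R).
Proof.
split.
  exists dist; split=> [x y|x y|x y z|x A|u cu].
  - split=> [xy0|->]; last by rewrite /dist subrr normr0.
    apply: circle_val_inj; apply/eqP; rewrite -subr_eq0 -normr_le0.
    by rewrite (le_trans (dist_ge x y))// xy0.
  - exact: distrC.
  - exact: ler_distD.
  - exact: dist_nbhs.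
  have w1 n : 1 <= w (circle_val (u n)).
    by have := circle_valP (u n); rewrite /w => u01; rewrite invf_ge1; lra.
  have /cvg_ex[L wL] : cvg (w (circle_val (u n)) @[n --> \oo]).
    apply/cauchy_cvgP/cauchy_exP => e e0; have [N NP] := cu e e0.
    by exists (w (circle_val (u N))); exists N => // n /= Nn; exact: NP.
  (* A limit [L] in [1, +oo) has the preimage [1 - L^-1] under [w], which is the limit point. *)
  have L1 : 1 <= L by apply: (cvgr_to_ge wL); exact: nearW.
  have l01 : 1 - L^-1 \in (`[0, 1[%classic : set R).
    rewrite inE /= in_itv /= subr_ge0 gtrBl invr_gt0 invf_le1; lra.
  exists (SigSub l01 : circle R) => A /dist_nbhs[e e0 eA].
  have /cvgrPdist_lt/(_ e e0) := wL.
  apply: filterS => n Ln; apply: eA; rewrite /= /dist.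
  by rewrite [X in w X](_ : _ = 1 - L^-1)// {1}/w subKr invrK.
exists [set Defs.frac (ratr q) | q in [set: rat]].
  by apply: (card_le_trans (card_image_le _ _)); exact: countableP.
move=> U [x Ux] oU; have : nbhs x U by exact: open_nbhs_nbhs.
move: oU; rewrite (open_circleE R) => -[B oB]; rewrite setTI => BU.
move: Ux; rewrite -{U}BU => Bx _.
have /nbhs_ballP[e /= e0 eB] := open_nbhs_nbhs (conj oB Bx).
have /andP[x0 x1] := circle_valP x.
(* The cap at 1 keeps the rational in [0, 1), where [frac] leaves the value unchanged. *)
have [q] : exists q, ratr q \in `]circle_val x, Num.min 1 (circle_val x + e)[.
  by apply: rat_in_itvoo; rewrite lt_min x1 ltrDl.
rewrite in_itv /= lt_min => /and3P[xq q1 qe].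
exists (Defs.frac (ratr q)); split; last by exists q.
apply: eB; rewrite /= circle_val_frac (@floor_def _ _ 0);
  last by rewrite add0r; lra.
by rewrite subr0 /ball /= ltr0_norm; lra.
Unshelve. all: by end_near.
Qed.

End Polish.

(** * Fast subsequences and the duality gap *)

(** Recursion on the list of earlier terms: each new term is the larger of the successor of the last
    one and the value of [F] on the list. *)
Lemma fast_subsequence (F : seq nat -> nat) : exists i : nat -> nat,
  [/\ (2 <= i 2)%N, forall j, (2 <= j)%N -> (i j < i j.+1)%N &
    forall j, (2 <= j)%N -> (F [seq i k | k <- iota 2 j.-1] <= i j.+1)%N].
Proof.
pose step s := rcons s (maxn (last 0%N s).+1 (F s)).
(* [s n] lists i_2, ..., i_{n+2}; by truncated subtraction [i 0] and [i 1] take the default value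
   2. *)
pose s n := iter n step [:: 2%N].
pose i j := last 0%N (s (j - 2)%N).
have iS n : i n.+3 = maxn (i n.+2).+1 (F (s n)).
  by rewrite /i !subSS !subn0 /= last_rcons.
have sE n : [seq i k | k <- iota 2 n.+1] = s n.
  elim: n => // n IH; rewrite -[n.+2]addn1 iotaD map_cat IH add2n.
  rewrite [map i (iota _ 1)]/= iS.
  by rewrite cats1 /s iterS /step /i !subSS !subn0.
exists i; split=> // -[|[|j]]// _; rewrite iS ?leq_maxl//.
by rewrite [_.-1]/= sE leq_maxr.
Qed.

Theorem proposition4p3 (R : realType) (alpha : R)
    (tau : nat -> borel (circle R) -> int) :
  0 <= alpha < 1 -> irrational alpha ->
  (forall x, tau 0%N x = 0) -> (forall x, tau 1%N x = 1) ->
  orbit_bijections alpha tau ->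
  concentrated_costs alpha tau ->
  approximate_potentials alpha tau ->
  near_identity alpha tau ->
  let mu := @lebesgue_circle R in
  (exists F : seq nat -> nat, forall i : nat -> nat,
    (2 <= i 2)%N ->
    (forall j, (2 <= j)%N -> (i j < i j.+1)%N) ->
    (forall j, (2 <= j)%N -> (F [seq i k | k <- iota 2 j.-1] <= i j.+1)%N) ->
    let c := cost alpha tau i in
    measurable_fun [set: (borel (circle R) * borel (circle R))%type] c /\
    [/\ (0 < primal mu mu c)%E,
        primal_rel mu mu c = 0%E,
        dual mu mu c = 0%E,
        dual_rel mu mu c = 0%E &
        (0 < primal mu mu c - dual_rel mu mu c)%E]) /\
  ~ relaxed_duality_conjecture R.
Proof.
move=> _ irr tau0 tau1 orb conc pot near_id mu.
have pT n : measure_preserving (rot_by alpha (tau n)) by have [_ ?] := orb n.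
have mT n : measurable_fun [set: borel (circle R)] (rot_by alpha (tau n)).
  by case: (pT n).
have int1 n : (\int[mu]_x cost_along alpha (tau n) x = 1)%E
  by have [_ _ _] := orb n.
set claim := (X in X /\ _).
have : claim.
  have /choice[N dualN] := almost_dual_ex irr tau0 mT pot near_id.
  (* The lists in [plan_cost_ge] begin with the indices 0 and 1 of the first two graphs, so [F]
     prefixes them. *)
  exists (fun s => N [:: 0, 1 & s]%N) => i i2 i_inc iF c.
  have i_mono j k : (2 <= j)%N -> (j <= k)%N -> (i j <= i k)%N.
    move=> j2; elim: k => [|k IH]; first by rewrite leqn0 => /eqP ->.
    rewrite leq_eqVlt => /predU1P[->//|]; rewrite ltnS => jk.
    by rewrite (leq_trans (IH jk))// ltnW// i_inc// (leq_trans j2).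
  have primal_ge : ((1 / 4)%:E <= primal mu mu c)%E.
    apply: le_ereal_inf_tmp => _ [pi plan ->].
    apply: (plan_cost_ge irr tau0 tau1 mT dualN _ plan) => j k j2 jk.
    (* Growth is imposed on the next term only; monotonicity carries the bound to all later ones. *)
    apply: leq_trans (iF j j2) _; apply: i_mono => //; exact: leqW.
  have primal_gt0 : (0 < primal mu mu c)%E.
    by apply: lt_le_trans primal_ge; rewrite lte_fin.
  have [d0 dr0] := dual_eq0 irr pT conc i_inc int1.
  split; first exact: measurable_cost.
  split=> //; first exact: primal_rel_eq0.
  by rewrite dr0 sube0.
move=> hclaim; split=> // conj.
(* One subsequence built for [F] yields a Borel cost on a product of Polish spaces for which the
   conjecture would equate a positive primal value with 0. *)
have [F FP] := hclaim; have [i [i2 i_inc iF]] := fast_subsequence F.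
have [mc [+ _ _ dr0 _]] := FP i i2 i_inc iF.
have := conj _ _ (polish_circle R) (polish_circle R) mu mu _ mc
  (cost_ge0 alpha tau i).
by rewrite dr0 => <-; rewrite ltxx.
Qed.
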